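(* Let $q(x,d)$ be the data distribution and $q(z|x,d)$ an encoder. For a density $p(z)$ on the latent space and a decoder $p(x|z,d)$ put $$\mathcal{L}(p(z),p(x|z,d)) = \mathbb{E}_{q(x,z,d)}\left[-\log\left(\frac{p(x|z,d)}{q(z|x,d)}\cdot p(z)\right)\right] + C,\qquad C = -\mathbb{E}_{q(d)}[\mathrm{H}(q(x|d))],$$ and define $$\mathrm{VAUB}(q(z|x,d)) = \min_{p(z),\,p(x|z,d)} \mathcal{L}(p(z),p(x|z,d)).$$ Then VAUB is an upper bound on the GJSD between the latent distributions, i.e. $$\mathrm{VAUB}(q(z|x,d)) \ \ge\ \mathrm{GJSD}(\{q(z|d)\}_{d=1}^k),$$ and the bound gap is $$\mathrm{KL}(q(z),p(z)) + \mathbb{E}_{q(d)q(z|d)}\big[\mathrm{KL}(q(x|z,d),p(x|z,d))\big],$$ that is, $\mathcal{L}(p(z),p(x|z,d)) - \mathrm{GJSD}(\{q(z|d)\}_{d=1}^k)$ equals this quantity for each choice of $p(z)$ and $p(x|z,d)$ (so the gap of VAUB is this quantity at the minimizing $p(z)$, $p(x|z,d)$). The bound can be made tight: if $p(z)$ and $p(x|z,d)$ are optimized over all possible densities, then $\mathrm{VAUB}(q(z|x,d)) = \mathrm{GJSD}(\{q(z|d)\}_{d=1}^k)$.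
   Context: Let $x$ be an observed continuous random vector and $d\in\{1,\dots,k\}$, $k>1$, a domain label, with joint data distribution $q(x,d)$; $q(d)$ is the marginal of $d$ and $q(x|d)$ the conditional density of $x$. The encoder $q(z|x,d)$ is a conditional density of a latent random vector $z$; the dimension of $z$ need not equal that of $x$. Set $q(x,d,z)=q(x,d)\,q(z|x,d)$; $q(z|d)=\int q(x|d)q(z|x,d)\,dx$, $q(z)=\sum_d q(d)q(z|d)$ and $q(x|z,d)$ denote the corresponding marginals and conditionals. A decoder $p(x|z,d)$ is a conditional density of $x$ given $(z,d)$, and $p(z)$ is a density on the latent space that does not depend on $d$. The minimum in VAUB is over given classes of such $p(z)$ and $p(x|z,d)$. $\mathrm{H}$ is (differential) entropy, $\mathrm{H_c}(p,q)=\mathbb{E}_p[-\log q]$ is cross entropy, and $\mathrm{KL}(p,q)=\mathrm{H_c}(p,q)-\mathrm{H}(p)$. The generalized Jensen-Shannon divergence is $$\mathrm{GJSD}(\{q(z|d)\}_{d=1}^k)=\mathrm{H}\big(\mathbb{E}_{q(d)}[q(z|d)]\big)-\mathbb{E}_{q(d)}[\mathrm{H}(q(z|d))].$$ All entropies and expectations appearing are understood to be well-defined and finite, and the minimum is understood to be attained. *)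

(* Defs.v *)
(* MathComp / MathComp-Analysis. *)
From HB Require Import structures.
From mathcomp Require Import all_boot all_order all_algebra.
From mathcomp Require Import all_classical all_reals all_analysis.
Set Implicit Arguments.
Unset Strict Implicit.
Unset Printing Implicit Defensive.
Import Order.TTheory GRing.Theory Num.Theory.
Import numFieldNormedType.Exports.
Local Open Scope classical_set_scope.
Local Open Scope ring_scope.
Local Open Scope ereal_scope.

(** * Lebesgue measure on R^n *)

(* R^n with the product Borel sigma-algebra generated by its coordinates. *)
Notation Rvec R n := (n.-tuple (measurableTypeR R)).

Section lebesgue_vector.
Context {R : realType}.

Definition vcons {n} (u : measurableTypeR R * Rvec R n) : Rvec R n.+1 :=
  [tuple of u.1 :: u.2].

Definition vuncons {n} (x : Rvec R n.+1) : measurableTypeR R * Rvec R n :=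
  (thead x, [tuple of behead x]).

Lemma vconsK n : cancel (@vcons n) vuncons.
Proof. by case=> a t; congr pair; apply: val_inj. Qed.

Lemma measurable_vcons n : measurable_fun setT (@vcons n).
Proof. exact: measurable_cons measurable_fst measurable_snd. Qed.

Lemma measurable_vuncons n : measurable_fun setT (@vuncons n).
Proof.
by apply/measurable_fun_pair; [exact: measurable_tnth|exact: measurable_behead].
Qed.

Section step.
Context {n : nat} (mu : {sigma_finite_measure set (Rvec R n) -> \bar R}).

Definition leb_step : set (Rvec R n.+1) -> \bar R :=
  pushforward (@lebesgue_measure R \x mu) vcons.

Let leb_step0 : leb_step set0 = 0.
Proof. by rewrite /leb_step /pushforward preimage_set0 measure0. Qed.

Let leb_step_ge0 A : 0 <= leb_step A.
Proof. exact: (@measure_ge0 _ _ _ (@lebesgue_measure R \x mu)). Qed.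

Let leb_step_sigma_additive : semi_sigma_additive leb_step.
Proof.
move=> F mF tF mUF; rewrite /leb_step /pushforward preimage_bigcup.
have mpre A : measurable A -> measurable (@vcons n @^-1` A).
  by move=> mA; rewrite -[X in measurable X]setTI; exact: measurable_vcons.
apply: measure_semi_sigma_additive.
- by move=> i; exact: mpre.
- apply/trivIsetP => /= i j _ _ ij; rewrite -preimage_setI.
  by move/trivIsetP : tF => /(_ _ _ _ _ ij) ->//; rewrite preimage_set0.
- by rewrite -preimage_bigcup; exact: mpre.
Qed.

HB.instance Definition _ := isMeasure.Build _ _ _
  leb_step leb_step0 leb_step_ge0 leb_step_sigma_additive.

Let leb_step_sigma_finite : sigma_finite setT leb_step.
Proof.
have /sigma_finiteP[F [FT ndF Foo]] := sigma_finiteT (@lebesgue_measure R).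
have /sigma_finiteP[G [GT ndG Goo]] := sigma_finiteT mu.
exists (fun i => vuncons @^-1` (F i `*` G i)).
  rewrite predeqE => x; split=> // _.
  have [i _ Fi] : (\bigcup_i F i) (vuncons x).1 by rewrite -FT.
  have [j _ Gj] : (\bigcup_i G i) (vuncons x).2 by rewrite -GT.
  exists (maxn i j) => //; split.
  - by move: Fi; exact/subsetPset/ndF/leq_maxl.
  - by move: Gj; exact/subsetPset/ndG/leq_maxr.
move=> i; have [mF Foo_i] := Foo i; have [mG Goo_i] := Goo i; split.
  rewrite -[X in measurable X]setTI; apply: measurable_vuncons => //.
  exact: measurableX.
rewrite /leb_step /pushforward -comp_preimage.
rewrite (_ : vuncons \o vcons = id); last by apply/funext => u; exact: vconsK.
by rewrite preimage_id product_measure1E// lte_mul_pinfty// ge0_fin_numE.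
Qed.

HB.instance Definition _ :=
  @Measure_isSigmaFinite.Build _ _ _ leb_step leb_step_sigma_finite.
End step.

(* Iterated product of the one-dimensional Lebesgue measure; R^0 is a point of
   mass 1. *)
Fixpoint leb (n : nat) : {sigma_finite_measure set (Rvec R n) -> \bar R} :=
  match n with
  | 0%N => \d_([tuple] : Rvec R 0)
  | n'.+1 => leb_step (leb n')
  end.

End lebesgue_vector.
Arguments leb {R} n.

(** * Densities, entropies, divergences *)

Section information.
Context d (T : measurableType d) (R : realType).
Variable mu : {sigma_finite_measure set T -> \bar R}.

Definition is_density (p : T -> R) : Prop :=
  [/\ measurable_fun setT p, forall x, (0 <= p x)%R &
      \int[mu]_x (p x)%:E = 1].

(* The logarithm is the extended one, with lne 0 = -oo, and 0 * +oo = 0: the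
   integrand is +oo where 0 = q < p, and 0 where p = 0. *)
Definition cross_integrand (p q : T -> R) (x : T) : \bar R :=
  (p x)%:E * - lne (q x)%:E.

Definition cross_entropy (p q : T -> R) : \bar R :=
  \int[mu]_x cross_integrand p q x.

Definition entropy (p : T -> R) : \bar R := cross_entropy p p.

Definition KL (p q : T -> R) : \bar R := cross_entropy p q - entropy p.

Definition finite_cross_entropy (p q : T -> R) : Prop :=
  mu.-integrable setT (cross_integrand p q).

Definition finite_entropy (p : T -> R) : Prop := finite_cross_entropy p p.

Definition GJSD (k : nat) (w : 'I_k -> R) (f : 'I_k -> T -> R) : \bar R :=
  entropy (fun x => \sum_(i < k) w i * f i x)%R
  - \sum_(i < k) (w i)%:E * entropy (f i).

(* r a i is a density on T for every value (a, i) of the conditioning pair, and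
   is jointly measurable in (a, x). *)
Definition is_conditional_density d' (A : measurableType d') (k : nat)
    (r : A -> 'I_k -> T -> R) : Prop :=
  (forall i, measurable_fun setT (fun u : A * T => r u.1 i u.2)) /\
  (forall a i, is_density (r a i)).

Definition is_joint_density (k : nat) (q : T -> 'I_k -> R) : Prop :=
  [/\ forall i, measurable_fun setT (q ^~ i),
      forall x i, (0 <= q x i)%R &
      \sum_(i < k) \int[mu]_x (q x i)%:E = 1].

End information.

(** * The variational alignment upper bound *)

(* X and Z are equipped with reference measures mu and nu; q is the joint
   density q(x, d) and e is the encoder, with e x d z = q(z | x, d).  Below,
   division by 0 is 0, and a divergent integral has real value 0 (Rintegral);
   for a joint density and an encoder this affects the conditional densities
   q(x|d), q(z|d) and q(x|z,d) only for conditioning values of probability 0. *)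
Section vaub.
Context dX dZ (X : measurableType dX) (Z : measurableType dZ) (R : realType).
Variables (mu : {sigma_finite_measure set X -> \bar R})
          (nu : {sigma_finite_measure set Z -> \bar R}).
Context (k : nat).
Variables (q : X -> 'I_k -> R) (e : X -> 'I_k -> Z -> R).

Definition q_d (d : 'I_k) : R := (\int[mu]_x q x d)%R.

Definition q_x_given_d (d : 'I_k) (x : X) : R := (q x d / q_d d)%R.

Definition q_xdz (x : X) (d : 'I_k) (z : Z) : R := (q x d * e x d z)%R.

Definition q_z_given_d (d : 'I_k) (z : Z) : R :=
  (\int[mu]_x (q_x_given_d d x * e x d z))%R.

Definition q_z (z : Z) : R := (\sum_(d < k) q_d d * q_z_given_d d z)%R.

Definition q_x_given_zd (z : Z) (d : 'I_k) (x : X) : R :=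
  (q_x_given_d d x * e x d z / q_z_given_d d z)%R.

(* p is the latent density p(z); r z d x = p(x | z, d) is the decoder. *)
Definition loss_integrand (p : Z -> R) (r : Z -> 'I_k -> X -> R) (d : 'I_k)
    (u : X * Z) : \bar R :=
  (q_xdz u.1 d u.2)%:E
  * - lne (r u.2 d u.1 / e u.1 d u.2 * p u.2)%:E.

Definition loss (p : Z -> R) (r : Z -> 'I_k -> X -> R) : \bar R :=
  \sum_(d < k) \int[mu \x nu]_u loss_integrand p r d u
  + - \sum_(d < k) (q_d d)%:E * entropy mu (q_x_given_d d).

(* Minimum over the classes P of latent densities and D of decoders; see
   VAUB_attained for its being reached. *)
Definition VAUB (P : set (Z -> R)) (D : set (Z -> 'I_k -> X -> R)) : \bar R :=
  ereal_inf [set l | exists p r, [/\ P p, D r & l = loss p r]].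

Definition VAUB_minimizer (P : set (Z -> R)) (D : set (Z -> 'I_k -> X -> R))
    (p : Z -> R) (r : Z -> 'I_k -> X -> R) : Prop :=
  [/\ P p, D r & loss p r = VAUB P D].

Definition VAUB_attained (P : set (Z -> R)) (D : set (Z -> 'I_k -> X -> R)) :
    Prop :=
  exists p r, VAUB_minimizer P D p r.

Definition latent_GJSD : \bar R := GJSD nu q_d q_z_given_d.

Definition decoder_KL_integrand (r : Z -> 'I_k -> X -> R) (d : 'I_k) (z : Z) :
    \bar R :=
  (q_d d * q_z_given_d d z)%:E * KL mu (q_x_given_zd z d) (r z d).

Definition gap (p : Z -> R) (r : Z -> 'I_k -> X -> R) : \bar R :=
  KL nu q_z p + \sum_(d < k) \int[nu]_z decoder_KL_integrand r d z.

(* All entropies and expectations occurring in the loss and in the gap at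
   (p, r) are well defined and finite. *)
Definition finite_at (p : Z -> R) (r : Z -> 'I_k -> X -> R) : Prop :=
  [/\ forall d, (mu \x nu).-integrable setT (loss_integrand p r d),
      finite_cross_entropy nu q_z p,
      forall d, {ae nu, forall z, finite_entropy mu (q_x_given_zd z d)},
      forall d, {ae nu, forall z,
        finite_cross_entropy mu (q_x_given_zd z d) (r z d)} &
      forall d, nu.-integrable setT (decoder_KL_integrand r d)].

End vaub.

(* Main.v *)
(* Let J_d(x, z) = q(x, d) q(z|x, d) and K_d(x, z) = p(z) q(d|z) p(x|z, d), with
   q(d|z) = q(d) q(z|d) / q(z).  The loss integrand is
     J_d log (J_d / K_d) - J_d log q(x|d) + J_d log q(z|d) - J_d log q(z),
   where the last three terms integrate to the entropies in C and in the GJSD.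
   Since J log (J / K) >= J - K and the K_d have total mass at most 1, the loss
   is at least the GJSD, whether or not it is finite.  For p(z) = q(z) and
   p(x|z, d) = q(x|z, d) one has J = K, hence equality.  The gap comes from
   log (J_d / K_d) = log (q(z) / p(z)) + log (q(x|z, d) / p(x|z, d)), integrated
   over x first. *)
Require Import Defs.
From mathcomp Require Import all_boot all_order all_algebra.
From mathcomp Require Import all_classical all_reals all_analysis.
From mathcomp Require Import measurable_realfun.
From mathcomp Require Import ring lra.
Set Implicit Arguments.
Unset Strict Implicit.
Unset Printing Implicit Defensive.
Import Order.TTheory GRing.Theory Num.Theory.
Local Open Scope classical_set_scope.
Local Open Scope ring_scope.
Local Open Scope ereal_scope.

(** The inequality ln t <= t - 1 at t = y / x, multiplied by x. It is the pointwise form of Gibbs'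
    inequality, used with x = J_d and y = K_d. *)
Lemma mulr_ln_div_le (R : realType) (x y : R) : (0 < x)%R -> (0 < y)%R ->
  (x * (ln y - ln x) <= y - x)%R.
Proof.
move=> x0 y0; rewrite -ln_div//.
have ln_le (t : R) : (0 < t -> ln t <= t - 1)%R.
  by move=> t0; have := @le_ln1Dx R (t - 1)%R; rewrite addrCA subrr addr0; apply; lra.
rewrite (le_trans (ler_wpM2l (ltW x0) (ln_le _ (divr_gt0 y0 x0))))//.
by rewrite mulrBr mulr1 mulrCA mulfV ?mulr1// gt_eqF.
Qed.

(** * Measurability, almost-everywhere comparison and real-valued integrals *)

Section measure_tools.
Context d (T : measurableType d) (R : realType).
Implicit Types (mu : {measure set T -> \bar R}).

Lemma measurable_lne_EFin (f : T -> R) : measurable_fun setT f ->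
  measurable_fun setT (fun x => lne (f x)%:E).
Proof.
move=> mf; rewrite /lne; apply: measurable_fun_ifT => //.
- exact: measurable_fun_ler.
- by apply/measurable_EFinP/measurableT_comp => //; exact: measurable_ln.
Qed.

(** Inversion agrees with the measurable function [powR] at exponent -1 on nonnegative arguments. *)
Lemma measurable_inv_ge0 (f : T -> R) : measurable_fun setT f ->
  (forall x, 0 <= f x)%R -> measurable_fun setT (fun x => (f x)^-1)%R.
Proof.
move=> mf f0; rewrite (_ : (fun _ => _) = (@powR R ^~ (-1)) \o f)%R.
  by apply: measurableT_comp => //; exact: measurable_powR.
by apply/funext => x /=; rewrite powR_inv1.
Qed.

Lemma integrable_ae_eq mu (f g : T -> \bar R) :
  mu.-integrable setT f -> measurable_fun setT g ->
  {ae mu, forall x, f x = g x} -> mu.-integrable setT g.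
Proof.
move=> /integrableP[mf fi] mg fg; apply/integrableP; split => //.
apply: le_lt_trans fi; apply: ae_ge0_le_integral => //.
- exact: measurableT_comp.
- exact: measurableT_comp.
- by apply: filterS fg => x -> _.
Qed.

Lemma integral_ae_eqT mu (f g : T -> \bar R) :
  measurable_fun setT f -> measurable_fun setT g ->
  {ae mu, forall x, f x = g x} -> \int[mu]_x f x = \int[mu]_x g x.
Proof. by move=> mf mg fg; apply: ae_eq_integral => //; apply: filterS fg. Qed.

(* [f] may be non-integrable: its integral is then [+oo]. *)
Lemma ae_le_integral_integrable mu (g f : T -> \bar R) :
  mu.-integrable setT g -> measurable_fun setT f ->
  {ae mu, forall x, g x <= f x} -> \int[mu]_x g x <= \int[mu]_x f x.
Proof.
move=> ig mf gf; have mg := measurable_int _ ig.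
rewrite integralE [leRHS]integralE; apply: leeB.
- apply: ae_ge0_le_integral => //; [exact: measurable_funepos..|].
  by apply: filterS gf => x gfx _; rewrite !funeposE ge_max !le_max lexx orbT gfx.
- apply: ae_ge0_le_integral => //; [exact: measurable_funeneg..|].
  apply: filterS gf => x gfx _.
  by rewrite !funenegE ge_max !le_max lexx orbT leeN2 gfx.
Qed.

Lemma ge0_integral_eq0_ae mu (f : T -> R) : measurable_fun setT f ->
  (forall x, 0 <= f x)%R -> \int[mu]_x (f x)%:E = 0 ->
  {ae mu, forall x, f x = 0%R}.
Proof.
move=> mf f0 if0; have mEf : measurable_fun setT (EFin \o f) by exact/measurable_EFinP.
have : ae_eq mu setT (EFin \o f) (cst 0).
  apply/(ae_eq_integral_abs _ measurableT mEf).
  by rewrite -[RHS]if0; apply: eq_integral => x _; rewrite gee0_abs ?lee_fin.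
by apply: filterS => x /(_ I) [].
Qed.

Lemma ge0_integrable_EFin mu (f : T -> R) (c : R) : measurable_fun setT f ->
  (forall x, 0 <= f x)%R -> \int[mu]_x (f x)%:E = c%:E ->
  mu.-integrable setT (fun x => (f x)%:E).
Proof.
move=> mf f0 fc; apply/integrableP; split; first exact/measurable_EFinP.
rewrite (_ : \int[_]_x _ = c%:E) ?ltry// -fc.
by apply: eq_integral => x _; rewrite gee0_abs ?lee_fin.
Qed.

(** Where [p x] is 0, the factor 0 absorbs the infinite logarithm, so an entropy integrand is always
    real and can be handled with [ln]. *)
Lemma cross_integrand_diag (p : T -> R) x : (0 <= p x)%R ->
  cross_integrand p p x = (p x * - ln (p x))%:E.
Proof.
rewrite /cross_integrand le_eqVlt => /predU1P[<-|p0]; first by rewrite !mul0e mul0r.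
by rewrite lne_EFin.
Qed.

(** Finiteness excludes [r x <= 0 < p x], the only case in which [lne] and [ln] lead to different
    products. For an integrable integrand this applies at almost every point. *)
Lemma cross_integrand_fin (p r : T -> R) x : (0 <= p x)%R ->
  cross_integrand p r x \is a fin_num ->
  cross_integrand p r x = (p x * - ln (r x))%:E.
Proof.
rewrite /cross_integrand le_eqVlt => /predU1P[<-|p0]; first by rewrite !mul0e mul0r.
have [r0|r0] := ltP 0%R (r x); first by rewrite lne_EFin.
by rewrite /lne r0/= gt0_muley ?lte_fin.
Qed.

(** Pairs integrability with a real value, so that sums and differences of integrals reduce to
    arithmetic in [R]. *)
Definition has_integral mu (f : T -> R) (v : R) : Prop :=
  mu.-integrable setT (fun x => (f x)%:E) /\ \int[mu]_x (f x)%:E = v%:E.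

Lemma integrable_has_integral mu (f : T -> R) :
  mu.-integrable setT (fun x => (f x)%:E) ->
  has_integral mu f (fine (\int[mu]_x (f x)%:E)).
Proof. by move=> fi; split => //; rewrite fineK// integrable_fin_num. Qed.

Lemma has_integralD mu (f g : T -> R) (v v' : R) :
  has_integral mu f v -> has_integral mu g v' ->
  has_integral mu (fun x => f x + g x)%R (v + v')%R.
Proof.
move=> [fi fv] [gi gv]; split; first exact: integrableD fi gi.
by under eq_integral do rewrite EFinD; rewrite integralD// fv gv.
Qed.

Lemma has_integralB mu (f g : T -> R) (v v' : R) :
  has_integral mu f v -> has_integral mu g v' ->
  has_integral mu (fun x => f x - g x)%R (v - v')%R.
Proof.
move=> [fi fv] [gi gv]; split; first exact: integrableB fi gi.
by under eq_integral do rewrite EFinB; rewrite integralB// fv gv.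
Qed.

End measure_tools.

(** * Fubini for a nonnegative density times a function of one coordinate *)

Section product_tools.
Context dX dZ (X : measurableType dX) (Z : measurableType dZ) (R : realType).
Variables (mu : {sigma_finite_measure set X -> \bar R})
          (nu : {sigma_finite_measure set Z -> \bar R}).
Context (F : X * Z -> R) (mF : measurable_fun setT F)
  (F0 : forall u, (0 <= F u)%R).

Let mEF : measurable_fun setT (EFin \o F). Proof. exact/measurable_EFinP. Qed.

(** Tonelli applied to the absolute value gives integrability on the product, after which Fubini
    integrates [F] over x and leaves its marginal [m]. The marginal is prescribed only almost
    everywhere because that is all that is known for q(z|d). *)
Lemma marginal2_integral (m g : Z -> R) :
  measurable_fun setT m -> measurable_fun setT g ->
  {ae nu, forall z, \int[mu]_x (F (x, z))%:E = (m z)%:E} ->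
  nu.-integrable setT (fun z => (m z * g z)%:E) ->
  (mu \x nu).-integrable setT (fun u => (F u * g u.2)%:E) /\
  \int[mu \x nu]_u (F u * g u.2)%:E = \int[nu]_z (m z * g z)%:E.
Proof.
move=> mm mg Fm mgi.
have mFg : measurable_fun setT (fun u => (F u * g u.2)%:E).
  apply/measurable_EFinP/measurable_funM => //.
  by apply: measurableT_comp => //; exact: measurable_snd.
have Fgi : (mu \x nu).-integrable setT (fun u => (F u * g u.2)%:E).
  apply/(integrable21ltyP _ _ mFg).
  have /integrableP[_] := mgi; apply: le_lt_trans.
  apply: ae_ge0_le_integral => //.
  - by move=> z _; exact: integral_ge0.
  - apply: (measurable_fun_fubini_tonelli_G
        (abse \o (fun u => (F u * g u.2)%:E))) => [|u]; last exact: abse_ge0.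
    exact: measurableT_comp.
  - by apply: measurableT_comp => //; exact/measurable_EFinP/measurable_funM.
  - apply: filterS Fm => z Fz _ /=.
    under eq_integral do rewrite normrM (ger0_norm (F0 _)) mulrC EFinM.
    rewrite ge0_integralZl//; first last.
    + by move=> x _; rewrite lee_fin.
    + exact: (measurable_fun_pair1 _ mEF).
    (* [m] has no prescribed sign, hence a comparison with its absolute value. *)
    rewrite Fz -EFinM lee_fin normrM mulrC ler_wpM2r//.
    exact: ler_norm.
split => //; rewrite -integral21_prod_meas1//.
apply: integral_ae_eqT.
- exact: measurable_fubini_G Fgi.
- exact: measurable_int mgi.
- apply: filterS Fm => z Fz; rewrite /fubini_G/=.
  under eq_integral do rewrite mulrC EFinM.
  rewrite integralZl//; first by rewrite Fz -EFinM mulrC.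
  apply: (ge0_integrable_EFin (c := m z)) => //.
  exact: (measurable_fun_pair1 _ mF).
Qed.

(** The same argument with the coordinates exchanged. Here the marginal is known at every x, since
    the encoder has mass 1 for each x. *)
Lemma marginal1_integral (m g : X -> R) :
  measurable_fun setT m -> measurable_fun setT g ->
  (forall x, \int[nu]_z (F (x, z))%:E = (m x)%:E) ->
  mu.-integrable setT (fun x => (m x * g x)%:E) ->
  (mu \x nu).-integrable setT (fun u => (F u * g u.1)%:E) /\
  \int[mu \x nu]_u (F u * g u.1)%:E = \int[mu]_x (m x * g x)%:E.
Proof.
move=> mm mg Fm mgi.
have mFg : measurable_fun setT (fun u => (F u * g u.1)%:E).
  apply/measurable_EFinP/measurable_funM => //.
  by apply: measurableT_comp => //; exact: measurable_fst.
have Fgi : (mu \x nu).-integrable setT (fun u => (F u * g u.1)%:E).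
  apply/(integrable12ltyP _ _ mFg).
  have /integrableP[_] := mgi; apply: le_lt_trans.
  apply: ge0_le_integral => //.
  - by move=> x _; exact: integral_ge0.
  - apply: (measurable_fun_fubini_tonelli_F
        (abse \o (fun u => (F u * g u.1)%:E))) => [|u]; last exact: abse_ge0.
    exact: measurableT_comp.
  - by apply: measurableT_comp => //; exact/measurable_EFinP/measurable_funM.
  - move=> x _ /=.
    under eq_integral do rewrite normrM (ger0_norm (F0 _)) mulrC EFinM.
    rewrite ge0_integralZl//; first last.
    + by move=> z _; rewrite lee_fin.
    + exact: (measurable_fun_pair2 _ mEF).
    rewrite Fm -EFinM lee_fin normrM mulrC ler_wpM2r//.
    exact: ler_norm.
split => //; rewrite -integral12_prod_meas1//.
apply: eq_integral => x _; rewrite /fubini_F/=.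
under eq_integral do rewrite mulrC EFinM.
rewrite integralZl//; first by rewrite Fm -EFinM mulrC.
apply: (ge0_integrable_EFin (c := m x)) => //.
exact: (measurable_fun_pair2 _ mF).
Qed.

End product_tools.

(** * Joint and marginal densities induced by the encoder *)

Section variational_bound.
Context dX dZ (X : measurableType dX) (Z : measurableType dZ) (R : realType).
Variables (mu : {sigma_finite_measure set X -> \bar R})
          (nu : {sigma_finite_measure set Z -> \bar R}).
Context (k : nat) (q : X -> 'I_k -> R) (e : X -> 'I_k -> Z -> R).
Hypotheses (q_density : is_joint_density mu q)
           (e_density : is_conditional_density nu e).

Local Notation w := (q_d mu q).
Local Notation a := (q_x_given_d mu q).
Local Notation b := (q_z_given_d mu q e).
Local Notation qz := (q_z mu q e).
Local Notation c := (q_x_given_zd mu q e).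

(** J_d, that is [q_xdz] as a function on the product space. *)
Definition joint_xz d (u : X * Z) : R := (q u.1 d * e u.1 d u.2)%R.
(** The joint density q(z, d), which is almost everywhere the z-marginal of J_d. *)
Definition joint_z d (z : Z) : R := (w d * b d z)%R.

Let mq d : measurable_fun setT (q ^~ d).
Proof. by case: q_density. Qed.

Let q0 x d : (0 <= q x d)%R.
Proof. by case: q_density. Qed.

Let me d : measurable_fun setT (fun u : X * Z => e u.1 d u.2).
Proof. by case: e_density. Qed.

Let mex d x : measurable_fun setT (e x d).
Proof. by have [_ /(_ x d)[]] := e_density. Qed.

Let e0 x d z : (0 <= e x d z)%R.
Proof. by have [_ /(_ x d)[]] := e_density. Qed.

Let e1 x d : \int[nu]_z (e x d z)%:E = 1.
Proof. by have [_ /(_ x d)[]] := e_density. Qed.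

Let q_integrable d : mu.-integrable setT (fun x => (q x d)%:E).
Proof.
apply/integrableP; split; first exact/measurable_EFinP.
apply: (@le_lt_trans _ _ (\sum_(i < k) \int[mu]_x (q x i)%:E)); last first.
  by case: q_density => _ _ ->; rewrite ltry.
rewrite (bigD1 d)//= -[leLHS]adde0; apply: leeD.
  by rewrite (eq_integral (fun x => (q x d)%:E))// => x _; rewrite ger0_norm.
by apply: sume_ge0 => i _; apply: integral_ge0 => x _; rewrite lee_fin.
Qed.

Let int_q d : \int[mu]_x (q x d)%:E = (w d)%:E.
Proof. by rewrite /q_d /Rintegral fineK// integrable_fin_num. Qed.

Lemma q_d_ge0 d : (0 <= w d)%R.
Proof. by apply: Rintegral_ge0 => x _. Qed.
Let w0 := q_d_ge0.

Lemma sum_q_d : (\sum_(d < k) w d = 1)%R.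
Proof.
apply: EFin_inj; rewrite -sumEFin; case: q_density => _ _ <-.
by apply: eq_bigr => d _; rewrite int_q.
Qed.

Let ma d : measurable_fun setT (a d).
Proof. exact: measurable_funM. Qed.

Let a0 d x : (0 <= a d x)%R.
Proof. by rewrite divr_ge0. Qed.

Lemma q_x_given_d_density d : w d != 0%R -> is_density mu (a d).
Proof.
move=> wd; split => //.
under eq_integral do rewrite /q_x_given_d mulrC EFinM.
by rewrite integralZl// int_q -EFinM mulVf.
Qed.

Let mjoint_xz d : measurable_fun setT (joint_xz d).
Proof.
apply: measurable_funM => //.
exact: (measurableT_comp (mq d) measurable_fst).
Qed.

Let joint_xz0 d u : (0 <= joint_xz d u)%R.
Proof. by apply: mulr_ge0. Qed.

Let joint_xz_marginal_x d x : \int[nu]_z (joint_xz d (x, z))%:E = (q x d)%:E.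
Proof.
under eq_integral do rewrite /joint_xz EFinM/=.
rewrite ge0_integralZl ?e1 ?mule1//; last by rewrite lee_fin.
- exact/measurable_EFinP.
- by move=> z _; rewrite lee_fin.
Qed.

Let has_integral_joint_xz d :
  has_integral (mu \x nu) (joint_xz d) (w d).
Proof.
have m1 : measurable_fun setT (cst 1%R : X -> R) by [].
have [|i1 i2] := marginal1_integral (mu := mu) (mjoint_xz d) (joint_xz0 d) (mq d) m1
  (joint_xz_marginal_x d).
  by apply: eq_integrable (q_integrable d) => // x _; rewrite mulr1.
split; first by apply: eq_integrable i1 => // u _; rewrite mulr1.
rewrite -int_q (eq_integral (fun u => (joint_xz d u * cst 1 u.1)%:E)) => [|u _].
  by rewrite i2; apply: eq_integral => x _; rewrite mulr1.
by rewrite mulr1.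
Qed.

Let encoder_joint_xz d x z : (a d x * e x d z = (w d)^-1 * joint_xz d (x, z))%R.
Proof. by rewrite /q_x_given_d /joint_xz/= mulrAC mulrC. Qed.

(* Only almost everywhere: [b d z] is 0 where its defining integral diverges. *)
Lemma joint_xz_marginal_z d :
  {ae nu, forall z, \int[mu]_x (joint_xz d (x, z))%:E = (joint_z d z)%:E}.
Proof.
apply: filterS (ae_integrable2 (has_integral_joint_xz d).1) => z /= iz.
rewrite /joint_z /q_z_given_d.
under eq_Rintegral do rewrite encoder_joint_xz.
rewrite RintegralZl//.
(* If [w d] is 0, then [joint_z d z] is 0, and [q x d] vanishes for almost every x, so the left side
   is 0 as well. *)
have [wd|wd] := eqVneq (w d) 0%R; last by rewrite mulVKf// fineK// integrable_fin_num.
rewrite wd mul0r.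
have := int_q d; rewrite wd => /ge0_integral_eq0_ae => /(_ (mq d) (q0 ^~ d)) qd0.
rewrite -[RHS](integral0 mu setT); apply: integral_ae_eqT => //.
- exact: measurable_int iz.
- by apply: filterS qd0 => x; rewrite /joint_xz/= => ->; rewrite mul0r.
Qed.

Let mae d : measurable_fun setT (fun u : X * Z => (a d u.1 * e u.1 d u.2)%R).
Proof.
apply: measurable_funM => //.
exact: (measurableT_comp (ma d) measurable_fst).
Qed.

Lemma measurable_q_z_given_d d : measurable_fun setT (b d).
Proof.
apply: measurableT_comp; first exact: fine_measurable.
apply: (measurable_fun_fubini_tonelli_G (fun u => (a d u.1 * e u.1 d u.2)%:E)).
  exact/measurable_EFinP.
by move=> u; rewrite lee_fin mulr_ge0.
Qed.
Let mb := measurable_q_z_given_d.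

Lemma q_z_given_d_ge0 d z : (0 <= b d z)%R.
Proof. by apply: Rintegral_ge0 => x _; rewrite mulr_ge0. Qed.
Let b0 := q_z_given_d_ge0.

Let mjoint_z d : measurable_fun setT (joint_z d).
Proof. exact: measurable_funM. Qed.

Let joint_z0 d z : (0 <= joint_z d z)%R.
Proof. by apply: mulr_ge0. Qed.

Let int_joint_z d : \int[nu]_z (joint_z d z)%:E = (w d)%:E.
Proof.
have [ij <-] := has_integral_joint_xz d.
rewrite -integral21_prod_meas1//; apply: integral_ae_eqT.
- exact/measurable_EFinP.
- exact: measurable_fubini_G ij.
- by apply: filterS (joint_xz_marginal_z d) => z <-.
Qed.

Lemma q_z_density : is_density nu qz.
Proof.
split.
- exact: (measurable_sum _ mjoint_z).
- by move=> z; apply: sumr_ge0 => d _; exact: joint_z0.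
- under eq_integral do rewrite /q_z -sumEFin.
  rewrite ge0_integral_sum//.
  + by rewrite (eq_bigr _ (fun d _ => int_joint_z d)) sumEFin sum_q_d.
  + by move=> d; apply/measurable_EFinP/mjoint_z.
  + by move=> d z _; rewrite lee_fin; exact: joint_z0.
Qed.
Let mqz : measurable_fun setT qz. Proof. by case: q_z_density. Qed.
Let qz0 z : (0 <= qz z)%R. Proof. by case: q_z_density. Qed.

Let joint_z_le_qz d z : (joint_z d z <= qz z)%R.
Proof. by rewrite /q_z (bigD1 d)//= lerDl; apply: sumr_ge0 => i _; exact: joint_z0. Qed.

(** The indicator [g] of the zero set of [joint_z d] has integral 0 against [joint_z d], hence also
    against J_d; so J_d vanishes almost everywhere on that set. This makes the logarithms of q(z|d)
    and q(z) genuine wherever J_d is positive. *)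
Lemma ae_joint_z_gt0 d :
  {ae mu \x nu, forall u, (0 < joint_xz d u)%R -> (0 < joint_z d u.2)%R}.
Proof.
pose g (z : Z) : R := (joint_z d z == 0%R)%:R.
have mg : measurable_fun setT g.
  rewrite (_ : g = fun z => if joint_z d z == 0%R then 1%R else 0%R).
    by apply: measurable_fun_ifT => //; exact: measurable_fun_eqr.
  by apply/funext => z; rewrite /g; case: eqP.
have lg z : (joint_z d z * g z = 0)%R.
  by rewrite /g; case: eqP => [->|]; rewrite ?mul0r ?mulr0.
have [|_] := marginal2_integral (mu := mu) (mjoint_xz d) (joint_xz0 d) (mjoint_z d) mg
  (joint_xz_marginal_z d).
  by under eq_fun do rewrite lg; exact: integrable0.
under [in X in _ = X -> _]eq_integral do rewrite lg.
rewrite integral0 => /ge0_integral_eq0_ae; move=> /(_ _ _)/filterS; apply.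
- move=> u /eqP; rewrite mulf_eq0 /g pnatr_eq0 eqb0 => /orP[/eqP->|l0 _].
    by rewrite ltxx.
  by rewrite lt0r l0; exact: joint_z0.
- apply: measurable_funM => //.
  by apply: measurableT_comp => //; exact: measurable_snd.
- by move=> u; rewrite mulr_ge0// ?joint_xz0// /g ler0n.
Qed.

(** * Entropies as integrals of logarithms against J_d *)

Lemma integral_joint_xz_ln_a d : finite_entropy mu (a d) ->
  (mu \x nu).-integrable setT (fun u => (joint_xz d u * - ln (a d u.1))%:E) /\
  \int[mu \x nu]_u (joint_xz d u * - ln (a d u.1))%:E = (w d)%:E * entropy mu (a d).
Proof.
move=> ia.
have qa x : (q x d * - ln (a d x))%:E = (w d)%:E * cross_integrand (a d) (a d) x.
  rewrite cross_integrand_diag// -EFinM mulrA; congr EFin.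
  (* If [w d] is 0, then [a d x] is 0 by the convention for division, and the default [ln 0 = 0]
     makes the left side 0. *)
  have [wd|wd] := eqVneq (w d) 0%R.
    by rewrite /q_x_given_d wd invr0 mulr0 ln0// oppr0 !mulr0.
  by rewrite /q_x_given_d mulrCA mulfV// mulr1.
have mla : measurable_fun setT (fun x => - ln (a d x))%R.
  by apply: measurable_funN; apply: measurableT_comp => //; exact: measurable_ln.
have [|i1 ->] := marginal1_integral (mu := mu) (mjoint_xz d) (joint_xz0 d) (mq d) mla
    (joint_xz_marginal_x d).
  by apply: eq_integrable (integrableZl measurableT (w d) ia).
by split => //; rewrite (eq_integral _ _ (fun x _ => qa x)) integralZl.
Qed.

Lemma integral_joint_xz_ln_b d : finite_entropy nu (b d) ->
  (mu \x nu).-integrable setT (fun u => (joint_xz d u * - ln (b d u.2))%:E) /\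
  \int[mu \x nu]_u (joint_xz d u * - ln (b d u.2))%:E = (w d)%:E * entropy nu (b d).
Proof.
move=> ib.
have qb z : (joint_z d z * - ln (b d z))%:E = (w d)%:E * cross_integrand (b d) (b d) z.
  by rewrite cross_integrand_diag// -EFinM mulrA.
have mlb : measurable_fun setT (fun z => - ln (b d z))%R.
  by apply: measurable_funN; apply: measurableT_comp => //; exact: measurable_ln.
have [|i1 ->] := marginal2_integral (mu := mu) (mjoint_xz d) (joint_xz0 d) (mjoint_z d) mlb
    (joint_xz_marginal_z d).
  by apply: eq_integrable (integrableZl measurableT (w d) ib).
by split => //; rewrite (eq_integral _ _ (fun x _ => qb x)) integralZl.
Qed.

(** The z-marginals of the J_d add up to q(z), and each is dominated by q(z), which gives
    integrability term by term. Applied to the negative logarithms of q(z) and of p(z). *)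
Lemma sum_integral_joint_xz (g : Z -> R) : measurable_fun setT g ->
  nu.-integrable setT (fun z => (qz z * g z)%:E) ->
  (forall d, (mu \x nu).-integrable setT (fun u => (joint_xz d u * g u.2)%:E)) /\
  \sum_(d < k) \int[mu \x nu]_u (joint_xz d u * g u.2)%:E =
  \int[nu]_z (qz z * g z)%:E.
Proof.
move=> mg ig.
have il d : nu.-integrable setT (fun z => (joint_z d z * g z)%:E).
  apply: le_integrable ig => //.
    by apply/measurable_EFinP/measurable_funM => //; exact: mjoint_z.
  move=> z _ /=; rewrite lee_fin normrM [leRHS]normrM ler_wpM2r//.
  by rewrite (ger0_norm (joint_z0 d z)) (ger0_norm (qz0 z)); exact: joint_z_le_qz.
have id d := marginal2_integral (mu := mu) (mjoint_xz d) (joint_xz0 d) (mjoint_z d) mg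
  (joint_xz_marginal_z d) (il d).
split => [d|]; first exact: (id d).1.
rewrite (eq_bigr _ (fun d _ => (id d).2)) -integral_sum//.
by apply: eq_integral => z _; rewrite sumEFin -mulr_suml.
Qed.

(** * The conditional density q(x|z, d) and positivity of the factors *)

Lemma q_x_given_zd_density z d : b d z != 0%R -> is_density mu (c z d).
Proof.
move=> bz.
have mae_z : measurable_fun setT (fun x => (a d x * e x d z)%R).
  exact: (measurable_fun_pair1 z (mae d)).
split.
- exact: measurable_funM.
- by move=> x; rewrite divr_ge0// mulr_ge0.
- have iae : \int[mu]_x (a d x * e x d z)%:E = (b d z)%:E.
    rewrite /q_z_given_d /Rintegral fineK//.
    (* An infinite integral would be sent to 0 by [fine], contradicting [bz]. *)
    by move: bz; rewrite /q_z_given_d /Rintegral; case: (\int[mu]_x _) => //=; rewrite eqxx.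
  under eq_integral do rewrite /q_x_given_zd mulrC EFinM.
  rewrite ge0_integralZl//.
  + by rewrite iae -EFinM mulVf.
  + exact/measurable_EFinP.
  + by move=> x _; rewrite lee_fin mulr_ge0.
  + by rewrite lee_fin invr_ge0.
Qed.

Lemma measurable_q_x_given_zd d :
  measurable_fun setT (fun u : X * Z => c u.2 d u.1).
Proof.
apply: measurable_funM => //; apply: measurable_inv_ge0 => //.
exact: (measurableT_comp (mb d) measurable_snd).
Qed.

(** Gives the positivity under which logarithms of products and quotients can be expanded. *)
Lemma joint_xz_gt0_factors d u : (0 < joint_z d u.2)%R -> (0 < joint_xz d u)%R ->
  [/\ 0 < w d, 0 < q u.1 d, 0 < b d u.2, 0 < e u.1 d u.2 & 0 < qz u.2]%R.
Proof.
have pos (x y : R) : (0 <= x -> 0 <= y -> 0 < x * y -> 0 < x /\ 0 < y)%R.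
  move=> x0 y0 xy; rewrite !lt0r x0 y0 !andbT; apply/andP.
  by rewrite -negb_or -mulf_eq0 gt_eqF.
move=> l0 j0; have [? ?] := pos _ _ (w0 d) (b0 d u.2) l0.
have [? ?] := pos _ _ (q0 u.1 d) (e0 u.1 d u.2) j0.
by split => //; exact: lt_le_trans (joint_z_le_qz d u.2).
Qed.

(** * Comparison of the loss with the GJSD under finite entropies *)

Section entropies.
Hypotheses (Ha : forall d, finite_entropy mu (a d))
  (Hb : forall d, finite_entropy nu (b d)) (Hqz : finite_entropy nu qz).

Let ha d : R := fine (entropy mu (a d)).
Let hb d : R := fine (entropy nu (b d)).
Let hz : R := fine (entropy nu qz).

Let haE d : entropy mu (a d) = (ha d)%:E.
Proof. by rewrite fineK// integrable_fin_num//; exact: Ha. Qed.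
Let hbE d : entropy nu (b d) = (hb d)%:E.
Proof. by rewrite fineK// integrable_fin_num//; exact: Hb. Qed.
Let hzE : entropy nu qz = hz%:E.
Proof. by rewrite fineK// integrable_fin_num//; exact: Hqz. Qed.

Lemma latent_GJSDE : latent_GJSD mu nu q e = (hz - \sum_(d < k) w d * hb d)%:E.
Proof.
rewrite /latent_GJSD /GJSD -/(q_z mu q e) hzE EFinB; congr (_ - _).
by rewrite -sumEFin; apply: eq_bigr => d _; rewrite hbE EFinM.
Qed.

Let integral_ln_qz : (forall d, (mu \x nu).-integrable setT
    (fun u => (joint_xz d u * - ln (qz u.2))%:E)) /\
  \sum_(d < k) \int[mu \x nu]_u (joint_xz d u * - ln (qz u.2))%:E = hz%:E.
Proof.
rewrite -hzE /entropy /cross_entropy.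
rewrite (eq_integral _ _ (fun z _ => cross_integrand_diag (qz0 z))).
apply: (@sum_integral_joint_xz (fun z => - ln (qz z))%R).
  by apply: measurable_funN; apply: measurableT_comp => //; exact: measurable_ln.
by apply: eq_integrable Hqz => // z _; rewrite cross_integrand_diag.
Qed.

Let has_integral_ln_a d :
  has_integral (mu \x nu) (fun u => joint_xz d u * - ln (a d u.1))%R (w d * ha d)%R.
Proof. by have [ia ea] := integral_joint_xz_ln_a (Ha d); split; rewrite // ea haE EFinM. Qed.

Let has_integral_ln_b d :
  has_integral (mu \x nu) (fun u => joint_xz d u * - ln (b d u.2))%R (w d * hb d)%R.
Proof. by have [ib eb] := integral_joint_xz_ln_b (Hb d); split; rewrite // eb hbE EFinM. Qed.

(** * Lower bound and gap for a fixed latent density and decoder *)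

Section at_pair.
Variables (p : Z -> R) (r : Z -> 'I_k -> X -> R).
Hypotheses (p_density : is_density nu p) (r_density : is_conditional_density mu r).

Let mp : measurable_fun setT p. Proof. by case: p_density. Qed.
Let p0 z : (0 <= p z)%R. Proof. by case: p_density. Qed.
Let mr d : measurable_fun setT (fun u : X * Z => r u.2 d u.1).
Proof.
have [/(_ d) mrd _] := r_density.
exact: (measurableT_comp mrd (@measurable_swap _ _ X Z)).
Qed.
Let r0 z d x : (0 <= r z d x)%R.
Proof. by have [_ /(_ z d)[]] := r_density. Qed.
Let r1 z d : \int[mu]_x (r z d x)%:E = 1.
Proof. by have [_ /(_ z d)[]] := r_density. Qed.

Lemma measurable_loss_integrand d :
  measurable_fun setT (loss_integrand q e p r d).
Proof.
apply: emeasurable_funM; first by apply/measurable_EFinP; exact: mjoint_xz.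
apply: measurableT_comp => //; apply: measurable_lne_EFin.
apply: measurable_funM; last exact: (measurableT_comp mp measurable_snd).
apply: measurable_funM => //; apply: measurable_inv_ge0; first exact: me.
by move=> u; exact: e0.
Qed.

Lemma loss_integrand_joint_xz0 d u : joint_xz d u = 0%R -> loss_integrand q e p r d u = 0.
Proof.
by rewrite /loss_integrand (_ : q_xdz q e u.1 d u.2 = joint_xz d u)// => ->; rewrite mul0e.
Qed.

(** A zero of [p] or of the decoder where J_d is positive costs [+oo]. Keeping this value lets the
    lower bound cover infinite losses. *)
Lemma loss_integrand_joint_xz_gt0 d u : (0 < joint_xz d u)%R -> (0 < e u.1 d u.2)%R ->
  loss_integrand q e p r d u =
  if (0 < r u.2 d u.1)%R && (0 < p u.2)%R then
    (joint_xz d u * (ln (e u.1 d u.2) - ln (r u.2 d u.1) - ln (p u.2)))%:E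
  else +oo.
Proof.
move=> j0 eu; rewrite /loss_integrand (_ : q_xdz q e u.1 d u.2 = joint_xz d u)//.
case: ifPn => [/andP[ru pu]|].
  rewrite lne_EFin ?mulr_gt0 ?invr_gt0// lnM ?posrE ?divr_gt0// ln_div ?posrE//.
  by rewrite -EFinN -EFinM; congr (EFin (_ * _)%R); ring.
rewrite negb_and -!leNgt => rp0.
suff -> : (r u.2 d u.1 / e u.1 d u.2 * p u.2 = 0)%R.
  by rewrite /lne lexx/= gt0_muley ?lte_fin.
by apply/eqP; rewrite !mulf_eq0 !eq_le r0 p0 !andbT orbAC rp0.
Qed.

(* p(z) q(d|z) p(x|z, d), where q(d|z) is 0 if q(z) = 0. *)
Let K d u : R := (r u.2 d u.1 * (p u.2 * (joint_z d u.2 / qz u.2)))%R.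

Let K0 d u : (0 <= K d u)%R.
Proof. by rewrite !mulr_ge0 ?invr_ge0//; exact: joint_z0. Qed.

(** The premise holds almost everywhere by [ae_joint_z_gt0]. Where J_d is 0 the claim reads -K_d <=
    0; where the integrand is [+oo] it is trivial; elsewhere it is [mulr_ln_div_le] with the
    logarithms expanded. *)
Lemma loss_integrand_ge d u : (0 < joint_xz d u -> 0 < joint_z d u.2)%R ->
  ((joint_xz d u - K d u) + (joint_xz d u * - ln (a d u.1) - joint_xz d u * - ln (b d u.2)
    + joint_xz d u * - ln (qz u.2)))%:E <= loss_integrand q e p r d u.
Proof.
move=> jl; have [j0|j0] := ltP 0%R (joint_xz d u); last first.
  have {}j0 : joint_xz d u = 0%R by apply/eqP; rewrite eq_le j0 joint_xz0.
  by rewrite loss_integrand_joint_xz0// j0 !mul0r subr0 addr0 sub0r addr0 lee_fin oppr_le0.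
have [wd qu bu eu qzu] := joint_xz_gt0_factors (jl j0) j0.
rewrite loss_integrand_joint_xz_gt0//; case: ifPn => [/andP[ru pu]|_]; last exact: leey.
have Ku : (0 < K d u)%R by rewrite !mulr_gt0 ?invr_gt0.
have := mulr_ln_div_le j0 Ku.
rewrite lee_fin /K /joint_z /joint_xz /q_x_given_d.
rewrite !(ln_div, lnM) ?posrE ?mulr_gt0 ?divr_gt0 ?mulr_gt0 ?invr_gt0//.
(* With J_d and K_d named, the inequality is linear in [t], [s] and the products of [t] with
   logarithms. *)
set t := (q u.1 d * e u.1 d u.2)%R; set s := (r u.2 d u.1 * _)%R; lra.
Qed.

(** Integrating the decoder over x leaves p(z) times the sum of the q(d|z), which is 1 where q(z) is
    nonzero and 0 elsewhere. Mass of p(z) on the zero set of q(z) is lost, hence only an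
    inequality. *)
Lemma sum_integral_K_le1 :
  (forall d, (mu \x nu).-integrable setT (fun u => (K d u)%:E)) /\
  \sum_(d < k) \int[mu \x nu]_u (K d u)%:E <= 1.
Proof.
pose g d z : R := (p z * (joint_z d z / qz z))%R.
have g0 d z : (0 <= g d z)%R by rewrite mulr_ge0// divr_ge0//; exact: joint_z0.
have mg d : measurable_fun setT (g d).
  apply: measurable_funM => //; apply: measurable_funM; first exact: mjoint_z.
  exact: measurable_inv_ge0.
have sum_g z : (\sum_(d < k) g d z <= p z)%R.
  rewrite -mulr_sumr -mulr_suml (_ : \sum_(i < k) joint_z i z = qz z)%R//.
  rewrite -[leRHS]mulr1 ler_wpM2l//.
  by have [->|?] := eqVneq (qz z) 0%R; rewrite ?mul0r// divff.
have g_le d z : (g d z <= p z)%R.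
  by rewrite (le_trans _ (sum_g z))// (bigD1 d)//= lerDl sumr_ge0.
have int_p : \int[nu]_z (p z)%:E = 1 by case: p_density.
have ip := ge0_integrable_EFin mp p0 int_p.
have ig d : nu.-integrable setT (fun z => (g d z)%:E).
  apply: le_integrable ip => //; first exact/measurable_EFinP.
  by move=> z _ /=; rewrite lee_fin !ger0_norm.
have m1 : measurable_fun setT (cst 1%R : Z -> R) by [].
have r1ae d : {ae nu, forall z, \int[mu]_x (r z d x)%:E = (cst 1%R z)%:E}.
  by apply: nearW.
have KE d := @marginal2_integral _ _ _ _ _ mu nu _ (mr d) (fun u => r0 u.2 d u.1)
  _ (g d) m1 (mg d) (r1ae d).
have ig1 d : nu.-integrable setT (fun z => (cst 1%R z * g d z)%:E).
  by apply: eq_integrable (ig d) => // z _; rewrite mul1r.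
split => [d|]; first exact: (KE d (ig1 d)).1.
rewrite (eq_bigr _ (fun d _ => (KE d (ig1 d)).2)) -integral_sum// -int_p.
apply: ge0_le_integral => //.
- by move=> z _; apply: sume_ge0 => d _; rewrite lee_fin mul1r.
- by apply: emeasurable_sum => d; exact: measurable_int (ig1 d).
- exact: measurable_int ip.
- move=> z _; rewrite sumEFin lee_fin (le_trans _ (sum_g z))//.
  by apply: ler_sum => d _; rewrite mul1r.
Qed.

Lemma lossE : loss mu nu q e p r =
  \sum_(d < k) \int[mu \x nu]_u loss_integrand q e p r d u
  + (- \sum_(d < k) w d * ha d)%:E.
Proof.
rewrite /loss EFinN -sumEFin; congr (_ - _).
by apply: eq_bigr => d _; rewrite haE EFinM.
Qed.

(** Integrates [loss_integrand_ge], whose left side is integrable. The J_d have total mass 1 and the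
    K_d at most 1, so J_d - K_d contributes a nonnegative total; the entropies of q(x|d) cancel
    against C. *)
Lemma latent_GJSD_le_loss : latent_GJSD mu nu q e <= loss mu nu q e p r.
Proof.
have [iK sK] := sum_integral_K_le1.
have [iz sz] := integral_ln_qz.
have hK d := integrable_has_integral (iK d).
have hzz d := integrable_has_integral (iz d).
have hG d := has_integralD (has_integralB (has_integral_joint_xz d) (hK d))
  (has_integralD (has_integralB (has_integral_ln_a d) (has_integral_ln_b d)) (hzz d)).
have le_loss d := ae_le_integral_integrable (hG d).1 (measurable_loss_integrand d)
  (filterS (@loss_integrand_ge d) (ae_joint_z_gt0 d)).
rewrite latent_GJSDE lossE; apply: le_trans; last first.
  by apply: leeD2r; apply: lee_sum => d _; exact: le_loss d.
rewrite (eq_bigr _ (fun d _ => (hG d).2)) sumEFin -EFinD lee_fin.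
move: sK sz; rewrite (eq_bigr _ (fun d _ => (hK d).2)).
rewrite (eq_bigr _ (fun d _ => (hzz d).2)).
rewrite !sumEFin lee_fin => sK [sz].
rewrite !big_split/= !sumrN sz sum_q_d; lra.
Qed.

(** The decoder part of J_d log (J_d / K_d); its integral over x is the weighted KL term of the
    gap. *)
Let log_ratio d (u : X * Z) : R := (joint_xz d u * (ln (c u.2 d u.1) - ln (r u.2 d u.1)))%R.

Let mlog_ratio d : measurable_fun setT (log_ratio d).
Proof.
apply: measurable_funM; first exact: mjoint_xz.
apply: measurable_funB; (apply: measurableT_comp; first exact: measurable_ln).
  exact: measurable_q_x_given_zd.
exact: mr.
Qed.

(** A finite value rules out the branch [+oo], so every logarithm can be expanded. The splitting
    uses p(z) in place of q(z), to produce the cross entropy of the gap. *)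
Lemma loss_integrand_fin d u : (0 < joint_xz d u -> 0 < joint_z d u.2)%R ->
  loss_integrand q e p r d u \is a fin_num ->
  loss_integrand q e p r d u =
  ((joint_xz d u * - ln (a d u.1) - joint_xz d u * - ln (b d u.2)
    + joint_xz d u * - ln (p u.2)) + log_ratio d u)%:E.
Proof.
move=> jl; have [j0|j0] := ltP 0%R (joint_xz d u); last first.
  have {}j0 : joint_xz d u = 0%R by apply/eqP; rewrite eq_le j0 joint_xz0.
  by rewrite loss_integrand_joint_xz0// /log_ratio j0 !mul0r subr0 !addr0.
have [wd qu bu eu qzu] := joint_xz_gt0_factors (jl j0) j0.
rewrite loss_integrand_joint_xz_gt0//; case: ifPn => // /andP[ru pu] _.
rewrite /log_ratio /q_x_given_zd /q_x_given_d !(ln_div, lnM) ?posrE ?mulr_gt0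
  ?divr_gt0 ?mulr_gt0 ?invr_gt0//.
by congr EFin; ring.
Qed.

(** Where [joint_z d z] is nonzero, J_d is [joint_z d z] times q(x|z, d), and the constant comes out
    of the integral of the KL integrand. Where it is 0, J_d vanishes for almost every x and both
    sides are 0. *)
Lemma integral_log_ratio d z : \int[mu]_x (joint_xz d (x, z))%:E = (joint_z d z)%:E ->
  finite_entropy mu (c z d) -> finite_cross_entropy mu (c z d) (r z d) ->
  \int[mu]_x (log_ratio d (x, z))%:E = decoder_KL_integrand mu q e r d z.
Proof.
move=> jz icc icr.
have mlog_ratio_z : measurable_fun setT (fun x => (log_ratio d (x, z))%:E).
  by apply/measurable_EFinP; exact: (measurable_fun_pair1 z (mlog_ratio d)).
rewrite /decoder_KL_integrand -/(joint_z d z).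
have [lz|lz] := eqVneq (joint_z d z) 0%R.
  rewrite lz mul0e -[RHS](integral0 mu setT); apply: integral_ae_eqT => //.
  move: jz; rewrite lz => /ge0_integral_eq0_ae => /(_ _ _)/filterS; apply.
  - by move=> x jxz; rewrite /log_ratio jxz mul0r.
  - exact: (measurable_fun_pair1 z (mjoint_xz d)).
  - by move=> x; exact: joint_xz0.
have [wd bz] : w d != 0%R /\ b d z != 0%R.
  by apply/andP; rewrite -negb_or -mulf_eq0.
have c0 x : (0 <= c z d x)%R by have [_ ->] := q_x_given_zd_density bz.
rewrite /KL /entropy /cross_entropy -integralB// -integralZl//; last exact: integrableB.
apply: integral_ae_eqT => //.
  by apply: measurable_funeM; apply: emeasurable_funB;
    [exact: measurable_int icr|exact: measurable_int icc].
apply: filterS (integrable_ae measurableT icr) => x /(_ I) /= /cross_integrand_fin ->//.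
rewrite cross_integrand_diag// -EFinB -EFinM /log_ratio.
have -> : joint_xz d (x, z) = (joint_z d z * c z d x)%R.
  by rewrite /joint_xz /joint_z /q_x_given_zd /q_x_given_d/=; field; rewrite wd bz.
by congr EFin => /=; ring.
Qed.

Lemma loss_sub_latent_GJSD : finite_at mu nu q e p r ->
  loss mu nu q e p r - latent_GJSD mu nu q e = gap mu nu q e p r.
Proof.
move=> [il ip icc icr idec].
have pE : {ae nu, forall z, cross_integrand qz p z = (qz z * - ln (p z))%:E}.
  apply: filterS (integrable_ae measurableT ip) => z /(_ I).
  exact: cross_integrand_fin.
have mlp : measurable_fun setT (fun z => - ln (p z))%R.
  by apply: measurable_funN; apply: measurableT_comp => //; exact: measurable_ln.
have mqzp : measurable_fun setT (fun z => (qz z * - ln (p z))%:E).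
  by apply/measurable_EFinP; exact: measurable_funM.
have [ijp sjp] := sum_integral_joint_xz mlp (integrable_ae_eq ip mqzp pE).
have hjp d := integrable_has_integral (ijp d).
have hS d := has_integralD
  (has_integralB (has_integral_ln_a d) (has_integral_ln_b d)) (hjp d).
have lossE_ae d : {ae mu \x nu, forall u, loss_integrand q e p r d u =
    ((joint_xz d u * - ln (a d u.1) - joint_xz d u * - ln (b d u.2)
      + joint_xz d u * - ln (p u.2)) + log_ratio d u)%:E}.
  apply: filterS2 (ae_joint_z_gt0 d) (integrable_ae measurableT (il d)) => u jl /(_ I).
  exact: loss_integrand_fin.
(* Obtained by subtraction: the loss integrand and the remaining terms are integrable. *)
have ilog_ratio d : (mu \x nu).-integrable setT (fun u => (log_ratio d u)%:E).
  apply: integrable_ae_eq (integrableB measurableT (il d) (hS d).1) _ _.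
    by apply/measurable_EFinP; exact: mlog_ratio.
  by apply: filterS (lossE_ae d) => u /= ->; rewrite -EFinB addrC addKr.
have hlog_ratio d := integrable_has_integral (ilog_ratio d).
have hT d := has_integralD (hS d) (hlog_ratio d).
have loss_d d := integral_ae_eqT (measurable_int _ (il d))
  (measurable_int _ (hT d).1) (lossE_ae d).
(* Fubini with x integrated first, so that the inner integral is the KL term at fixed z. *)
have dec d : \int[nu]_z decoder_KL_integrand mu q e r d z =
    \int[mu \x nu]_u (log_ratio d u)%:E.
  rewrite -integral21_prod_meas1//; apply: integral_ae_eqT.
  - exact: measurable_int (idec d).
  - exact: measurable_fubini_G (ilog_ratio d).
  - apply: filterS3 (joint_xz_marginal_z d) (icc d) (icr d) => z jz cz rz.
    by rewrite /fubini_G integral_log_ratio.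
rewrite latent_GJSDE lossE /gap /KL hzE.
rewrite /cross_entropy (integral_ae_eqT (measurable_int _ ip) mqzp pE) -sjp.
rewrite (eq_bigr _ (fun d _ => dec d)) (eq_bigr _ (fun d _ => loss_d d)).
rewrite (eq_bigr _ (fun d _ => (hT d).2)) (eq_bigr _ (fun d _ => (hlog_ratio d).2)).
rewrite (eq_bigr _ (fun d _ => (hjp d).2)) !sumEFin -!EFinN -!EFinD.
by congr EFin; rewrite !big_split/= !sumrN; ring.
Qed.

End at_pair.

(** * A pair at which the bound is an equality *)

Lemma exists_q_d_neq0 : exists d, w d != 0%R.
Proof.
apply/existsP; apply: contraT; rewrite negb_exists => /forallP wd.
have := sum_q_d; rewrite big1; first by move/eqP; rewrite eq_sym oner_eq0.
by move=> d _; apply/eqP; rewrite -[_ == _]negbK.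
Qed.

(** The pair is q(z) and q(x|z, d), the latter completed to a density for every (z, d). Then J_d =
    K_d almost everywhere where J_d is positive, and only the entropy terms remain. *)
Lemma loss_eq_latent_GJSD : exists p r,
  [/\ is_density nu p, is_conditional_density mu r &
      loss mu nu q e p r = latent_GJSD mu nu q e].
Proof.
have [d0 wd0] := exists_q_d_neq0.
have a_d0 := q_x_given_d_density wd0.
(* [c z d] is not a density where [b d z = 0]; any density will do there. *)
pose r z d x : R := if b d z == 0%R then a d0 x else c z d x.
have r_density : is_conditional_density mu r.
  split => [d|z d].
  - apply: measurable_fun_ifT.
    + by apply: measurable_fun_eqr => //; exact: (measurableT_comp (mb d) measurable_fst).
    + exact: (measurableT_comp (ma d0) measurable_snd).
    + exact: (measurableT_comp (measurable_q_x_given_zd d) (@measurable_swap _ _ Z X)).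
  - rewrite /r (_ : (fun _ => _) = if b d z == 0%R then a d0 else c z d); last first.
      by apply/funext => x; case: ifP.
    by case: ifPn => // bz; exact: q_x_given_zd_density.
exists qz, r; split => //; first exact: q_z_density.
have [izz sz] := integral_ln_qz.
have hzz d := integrable_has_integral (izz d).
have hT d := has_integralD
  (has_integralB (has_integral_ln_a d) (has_integral_ln_b d)) (hzz d).
have loss_d d : \int[mu \x nu]_u loss_integrand q e qz r d u =
    \int[mu \x nu]_u (joint_xz d u * - ln (a d u.1) - joint_xz d u * - ln (b d u.2)
      + joint_xz d u * - ln (qz u.2))%:E.
  apply: integral_ae_eqT.
  - exact: measurable_loss_integrand q_z_density r_density d.
  - exact: measurable_int (hT d).1.
  - apply: filterS (ae_joint_z_gt0 d) => u jl.
    have [j0|j0] := ltP 0%R (joint_xz d u); last first.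
      have {}j0 : joint_xz d u = 0%R by apply/eqP; rewrite eq_le j0 joint_xz0.
      by rewrite loss_integrand_joint_xz0// j0 !mul0r subr0 addr0.
    have [wd qu bu eu qzu] := joint_xz_gt0_factors (jl j0) j0.
    (* [b d u.2] is positive here, so the substitute density is not selected. *)
    have rE : r u.2 d u.1 = c u.2 d u.1 by rewrite /r gt_eqF.
    have cu : (0 < c u.2 d u.1)%R.
      by rewrite /q_x_given_zd /q_x_given_d divr_gt0// mulr_gt0// divr_gt0.
    rewrite (loss_integrand_joint_xz_gt0 q_z_density r_density)// rE cu qzu/=.
    rewrite /q_x_given_zd /q_x_given_d !(ln_div, lnM) ?posrE ?mulr_gt0
      ?divr_gt0 ?mulr_gt0 ?invr_gt0//.
    by congr EFin; ring.
rewrite latent_GJSDE lossE (eq_bigr _ (fun d _ => loss_d d)).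
rewrite (eq_bigr _ (fun d _ => (hT d).2)) sumEFin -EFinD.
move: sz; rewrite (eq_bigr _ (fun d _ => (hzz d).2)) sumEFin => -[sz].
by congr EFin; rewrite !big_split/= !sumrN sz; ring.
Qed.

End entropies.
End variational_bound.

(** * Specialization to Lebesgue densities and passage to the minimum *)

Theorem theorem1 (R : realType) (n m k : nat) (k_gt1 : (1 < k)%N)
    (q : Rvec R n -> 'I_k -> R) (e : Rvec R n -> 'I_k -> Rvec R m -> R)
    (q_density : is_joint_density (leb n) q)
    (e_density : is_conditional_density (leb m) e)
    (Hx_fin : forall d, finite_entropy (leb n) (q_x_given_d (leb n) q d))
    (Hzd_fin : forall d, finite_entropy (leb m) (q_z_given_d (leb n) q e d))
    (Hz_fin : finite_entropy (leb m) (q_z (leb n) q e)) :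
  let GJSDz := latent_GJSD (leb n) (leb m) q e in
  let L := loss (leb n) (leb m) q e in
  let V := VAUB (leb n) (leb m) q e in
  let all_p : set (Rvec R m -> R) := [set p | is_density (leb m) p] in
  let all_r : set (Rvec R m -> 'I_k -> Rvec R n -> R) :=
    [set r | is_conditional_density (leb n) r] in
  [/\ (* upper bound, and its gap at the minimizing pair *)
      forall (P : set (Rvec R m -> R))
             (D : set (Rvec R m -> 'I_k -> Rvec R n -> R)),
        P `<=` all_p -> D `<=` all_r ->
        VAUB_attained (leb n) (leb m) q e P D ->
        GJSDz <= V P D /\
        (forall p r, VAUB_minimizer (leb n) (leb m) q e P D p r ->
           finite_at (leb n) (leb m) q e p r ->
           V P D - GJSDz = gap (leb n) (leb m) q e p r),
      (* gap identity for every latent density and every decoder *)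
      forall p r, all_p p -> all_r r ->
        finite_at (leb n) (leb m) q e p r ->
        L p r - GJSDz = gap (leb n) (leb m) q e p r &
      (* tightness over all densities *)
      VAUB_attained (leb n) (leb m) q e all_p all_r /\
      V all_p all_r = GJSDz].
Proof.
move=> GJSDz L V all_p all_r.
have lower p r : all_p p -> all_r r -> GJSDz <= L p r.
  exact: latent_GJSD_le_loss.
have gapE p r : all_p p -> all_r r -> finite_at (leb n) (leb m) q e p r ->
    L p r - GJSDz = gap (leb n) (leb m) q e p r.
  exact: loss_sub_latent_GJSD.
split => //.
- move=> P D Pp Dr att; split.
    have [p [r [Pp' Dr' lV]]] := att; rewrite /V -lV.
    by apply: lower; [exact: Pp|exact: Dr].
  move=> p r [Pp' Dr' lV] fin; rewrite /V -lV.
  by apply: gapE; [exact: Pp|exact: Dr|].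
- have [p [r [pd rd lE]]] :=
    loss_eq_latent_GJSD q_density e_density Hx_fin Hzd_fin Hz_fin.
  (* The explicit pair bounds the infimum from above and [lower] bounds it from below; the same pair
     then witnesses that the minimum is attained. *)
  have VE : V all_p all_r = GJSDz.
    apply/eqP; rewrite eq_le; apply/andP; split.
      by apply: ereal_inf_lbound; exists p, r.
    by apply: le_ereal_inf_tmp => _ [p' [r' [pd' rd' ->]]]; exact: lower.
  by split => //; exists p, r; split => //; exact: etrans lE (esym VE).
Qed.
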